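(* For every integer $t \geq 5$, there exists a Hamiltonian chordal graph $G$ which is not fully cycle extendible and which has a decomposition tree $T$ with exactly $t-2$ branch vertices and exactly $t$ leaves.
   Context: All graphs are simple, finite, connected and undirected. A graph is chordal if it has no induced cycle of length at least $4$. A graph $G$ is cycle extendible if for every non-Hamiltonian cycle $C$ of $G$ there is a cycle $C'$ with $V(C) \subset V(C')$ and $|V(C')| = |V(C)| + 1$; it is fully cycle extendible if it is cycle extendible and every vertex lies in a triangle. A decomposition tree of a graph $G$ is a tree $T$ together with a collection $\{T_v : v \in V(G)\}$ of subtrees of $T$ such that $G$ is the intersection graph of this collection, i.e. for distinct $u, v \in V(G)$, $uv \in E(G)$ if and only if $V(T_u) \cap V(T_v) \neq \emptyset$ (a graph is chordal iff it has such a representation). A branch vertex of a tree $T$ is a vertex of degree at least $3$ in $T$. *)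

(* Defs.v *)
From mathcomp Require Import all_boot.

Set Implicit Arguments.
Unset Strict Implicit.
Unset Printing Implicit Defensive.

Record sgraph := SGraph {
  vertex :> finType;
  adj : rel vertex;
  adj_sym : symmetric adj;
  adj_irr : irreflexive adj }.

Section Graphs.
Variable G : sgraph.
Implicit Types (x y v : G) (c : seq G).

Definition connected : Prop :=
  0 < #|G| /\ forall x y, connect (@adj G) x y.

(* A cycle is listed by its vertices in cyclic order; these are pairwise
   distinct, so [size c] is both its length and the number of its vertices. *)
Definition is_cycle c : bool := (2 < size c) && ucycleb (@adj G) c.

Definition hamiltonian_cycle c : Prop := is_cycle c /\ forall v, v \in c.

Definition hamiltonian : Prop := exists c, hamiltonian_cycle c.

Definition induced_cycle c : Prop :=
  is_cycle c /\
  {in c &, forall x y, adj x y -> y = next c x \/ x = next c y}.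

Definition chordal : Prop :=
  ~ exists c, induced_cycle c /\ 4 <= size c.

Definition cycle_extendible : Prop :=
  forall c, is_cycle c -> ~ hamiltonian_cycle c ->
    exists c', [/\ is_cycle c', {subset c <= c'} & size c' = size c + 1].

Definition in_triangle v : Prop :=
  exists c, [/\ is_cycle c, size c = 3 & v \in c].

Definition fully_cycle_extendible : Prop :=
  cycle_extendible /\ forall v, in_triangle v.

Definition is_tree : Prop := connected /\ ~ exists c, is_cycle c.

Definition degree v : nat := #|[set u | adj v u]|.

Definition branch_vertices : {set G} := [set v | 3 <= degree v].

Definition leaves : {set G} := [set v | degree v == 1].

Section Induced.
Variable S : {set G}.

Definition induced_adj : rel {x | x \in S} := relpre val (@adj G).

Lemma induced_adj_sym : symmetric induced_adj.
Proof. by move=> x y; apply: adj_sym. Qed.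

Lemma induced_adj_irr : irreflexive induced_adj.
Proof. by move=> x; apply: adj_irr. Qed.

Definition induced : sgraph := SGraph induced_adj_sym induced_adj_irr.

End Induced.

End Graphs.

(* A connected subgraph of a tree is induced, so a subtree of a tree is given
   by its vertex set. *)
Definition subtree (T : sgraph) (S : {set T}) : Prop := is_tree (induced S).

Definition decomposition_tree (G T : sgraph) (sub : G -> {set T}) : Prop :=
  [/\ is_tree T,
      forall v : G, subtree (sub v) &
      forall u v : G, u != v -> (adj u v <-> sub u :&: sub v != set0)].

(* Main.v *)
(** A cycle [C] fails to be extendible as soon as no single vertex outside [C]
can be added, even though adding several of them at once is possible.  In the
15-vertex graph below, the vertices 10, ..., 14 have degree 2 and so force both
their edges into any cycle through them; there is a Hamiltonian cycle, and a
cycle through all the vertices but 0 and 2, but no cycle misses exactly one of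
0 and 2.  The graph is the intersection graph of subtrees of a tree with 11
nodes, 5 leaves and 3 branch vertices; replacing a leaf of the tree by a branch
vertex with two new leaves, which belong to no subtree, raises both numbers by
one and preserves the intersection graph. *)
Require Import Defs.
From mathcomp Require Import all_boot.

Set Implicit Arguments.
Unset Strict Implicit.
Unset Printing Implicit Defensive.

(** * Chordality from elimination orders *)

Lemma has_maximal_rank (A : eqType) (r : A -> nat) (s : seq A) (x0 : A) :
  x0 \in s -> exists2 x, x \in s & {in s, forall y, r y <= r x}.
Proof.
elim: s x0 => // a s IHs x0 _; case: s IHs => [|b s] IHs.
  by exists a; rewrite ?mem_head // => y; rewrite inE => /eqP->.
have [x xs xmax] := IHs b (mem_head _ _).
case: (leqP (r a) (r x)) => [ax|xa].
  exists x; first by rewrite inE xs orbT.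
  by move=> y; rewrite inE => /orP[/eqP->|/xmax].
exists a; first exact: mem_head.
move=> y; rewrite inE => /orP[/eqP->//|/xmax yx].
exact: leq_trans yx (ltnW xa).
Qed.

(** Brings a vertex of largest rank to the front, so that its two neighbours on the cycle are the
    second and the last entry. Both chordality and acyclicity are refuted at this vertex. *)
Lemma rot_cycle_max (G : sgraph) (r : G -> nat) (c : seq G) :
  is_cycle c ->
  exists i v u w p,
    [/\ rot i c = v :: u :: rcons p w, uniq (rot i c), adj v u, adj v w &
        {in c, forall x, r x <= r v}].
Proof.
case/andP=> sc /andP[cc uc].
have [x0 x0c] : exists x0, x0 \in c.
  by case: c sc {cc uc} => // a c _; exists a; exact: mem_head.
have [v vc vmax] := has_maximal_rank r x0c.
have [i c' rc] := rot_to vc.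
move: sc cc uc; rewrite -(size_rot i) -(rot_cycle i) -(rot_uniq i) rc.
case: c' rc => [//|u p]; case/lastP: p => [//|p w] rc _ cc uc.
exists i, v, u, w, p; split=> //; first by rewrite rc.
- by case/andP: cc.
- by move: cc => /= /andP[_]; rewrite rcons_path last_rcons adj_sym => /andP[].
Qed.

(** At the top vertex of a cycle, both cycle neighbours rank lower and so are adjacent, which gives
    a chord once the length is at least 4. *)
Lemma chordal_elimination_order (G : sgraph) (r : G -> nat) :
  injective r ->
  (forall v u w, adj v u -> adj v w -> r u < r v -> r w < r v ->
     u != w -> adj u w) ->
  chordal G.
Proof.
move=> r_inj simpl [c [[cc ind] sc]].
have [i [v [u [w [p [rc uc vu vw vmax]]]]]] := rot_cycle_max r cc.
have memc x : (x \in c) = (x \in v :: u :: rcons p w) by rewrite -rc mem_rot.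
have uc0 : uniq c by rewrite -(rot_uniq i).
have lt_v x : x \in c -> adj v x -> r x < r v.
  move=> xc vx; rewrite ltn_neqAle vmax // andbT; apply/eqP => /r_inj xv.
  by rewrite xv adj_irr in vx.
have u_c : u \in c by rewrite memc !inE eqxx orbT.
have w_c : w \in c by rewrite memc !inE mem_rcons mem_head !orbT.
have uw : adj u w.
  apply: (simpl v); rewrite ?lt_v //.
  move: uc; rewrite rc /= mem_rcons inE !negb_or.
  by case/and3P=> _ /andP[].
have nextE := next_rot i uc0.
have nvu : next c v = u by rewrite -nextE rc /= eqxx.
(* If [u] followed [w], then [w] would be [v]. If [w] followed [u], then [w] would be the third
   entry, which differs from the last in length at least 4. *)
have [] := ind u w u_c w_c uw; last first.
  rewrite -nvu => /(can_inj (prev_next uc0)) vw_eq.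
  by rewrite vw_eq adj_irr in vw.
rewrite -nextE rc.
move: sc uc; rewrite -(size_rot i) rc.
case: p {rc memc} => [//|a p] _ /= /and4P[v_c _ a_p _].
move: v_c; rewrite inE negb_or eq_sym => /andP[/negPf-> _]; rewrite eqxx => aw.
by rewrite -aw mem_rcons mem_head in a_p.
Qed.

(** * Trees certified by a rank function *)

Section RankedTrees.
Variables (T : sgraph) (r : T -> nat).

(** The rank acts as a depth that may have ties. The comparisons are not strict because a maximal
    vertex of a cycle yields only [<=]. *)
Definition unique_parents : Prop :=
  forall x y z, adj x y -> adj x z -> r y <= r x -> r z <= r x -> y = z.

Definition rooted (S : {set T}) : Prop :=
  exists2 root, root \in S &
    forall x, x \in S -> x != root ->
      exists y, [/\ y \in S, adj x y & r y < r x].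

(** The top vertex of a cycle would have two distinct parents. *)
Lemma unique_parents_acyclic : unique_parents -> ~ exists c, @is_cycle T c.
Proof.
move=> uniqT [c cc].
have [i [v [u [w [p [rc uc vu vw vmax]]]]]] := rot_cycle_max r cc.
have uw : u = w by apply: (uniqT v) => //; apply: vmax;
  rewrite -(mem_rot i) rc !inE ?mem_rcons ?inE eqxx ?orbT.
by move: uc; rewrite rc uw /= mem_rcons mem_head andbF.
Qed.

Lemma rooted_connected : rooted [set: T] -> connected T.
Proof.
case=> root _ desc.
have to_root x : connect (@adj T) x root.
  have [k] := ubnP (r x); elim: k x => // k IHk x rx.
  have [->|xr] := eqVneq x root; first exact: connect0.
  have [y [_ xy yx]] := desc x (in_setT x) xr.
  exact: connect_trans (connect1 xy) (IHk y (leq_trans yx rx)).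
split=> [|x y]; first by apply/card_gt0P; exists root.
apply: connect_trans (to_root x) _.
by rewrite (sym_connect_sym (@adj_sym T)).
Qed.

End RankedTrees.

Lemma rooted_tree (T : sgraph) (r : T -> nat) :
  unique_parents r -> rooted r [set: T] -> is_tree T.
Proof.
by move=> uniqT rT; split; [exact: rooted_connected rT
  | exact: unique_parents_acyclic uniqT].
Qed.

Lemma rooted_subtree (T : sgraph) (r : T -> nat) (S : {set T}) :
  unique_parents r -> rooted r S -> subtree S.
Proof.
move=> uniqT [root rootS desc].
apply: (@rooted_tree (induced S) (r \o val)).
  move=> x y z xy xz yx zx; apply: val_inj.
  exact: uniqT xy xz yx zx.
exists (exist _ root rootS) => // -[x xS] _ neq_x.
have [y [yS xy yx]] := desc x xS neq_x.
by exists (exist _ y yS).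
Qed.

(** * Growing the tree at a leaf *)

Section Sprout.
Variables (T : sgraph) (r : T -> nat) (x0 : T).

(** The two booleans are new pendant nodes, both attached to [x0]. *)
Definition sprout_adj : rel (T + bool) := fun x y =>
  match x, y with
  | inl x, inl y => adj x y
  | inl x, inr _ => x == x0
  | inr _, inl y => y == x0
  | inr _, inr _ => false
  end.

Lemma sprout_adj_sym : symmetric sprout_adj.
Proof. by move=> [x|b] [y|b'] //=; rewrite adj_sym. Qed.

Lemma sprout_adj_irr : irreflexive sprout_adj.
Proof. by move=> [x|b] //=; rewrite adj_irr. Qed.

Definition sprout : sgraph := SGraph sprout_adj_sym sprout_adj_irr.

Definition sprout_rank (x : sprout) : nat :=
  if x is inl y then r y else (r x0).+1.

Lemma sprout_unique_parents : unique_parents r -> unique_parents sprout_rank.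
Proof.
move=> uniqT [x|b] [y|b'] [z|b''] //=; rewrite /adj /=.
- by move=> xy xz yx zx; congr inl; exact: uniqT xy xz yx zx.
- by move=> _ /eqP->; rewrite ltnn.
- by move=> /eqP-> _; rewrite ltnn.
- by move=> /eqP->; rewrite ltnn.
- by move=> /eqP-> /eqP->.
Qed.

Lemma sprout_rooted (S : {set T}) :
  rooted r S -> rooted sprout_rank [set inl x | x in S].
Proof.
case=> root rootS desc; exists (inl root); first exact: imset_f.
move=> _ /imsetP[x xS ->] neq_x.
have [|y [yS xy yx]] := desc x xS; first by apply: contraNneq neq_x => ->.
by exists (inl y); split=> //; exact: imset_f.
Qed.

Lemma sprout_rootedT : rooted r [set: T] -> rooted sprout_rank [set: sprout].
Proof.
case=> root rootS desc; exists (inl root) => // -[x|b] _ neq_x.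
  have [|y [yS xy yx]] := desc x (in_setT x).
    by apply: contraNneq neq_x => ->.
  by exists (inl y).
by exists (inl x0); split=> //=; rewrite /adj /= eqxx.
Qed.

Lemma degreeE (G : sgraph) (x : G) : degree x = \sum_y adj x y.
Proof. by rewrite /degree -sum1dep_card big_mkcond. Qed.

Lemma degree_sprout_inl (x : T) :
  degree (inl x : sprout) = degree x + 2 * (x == x0).
Proof.
rewrite !degreeE big_sumType /=; congr (_ + _).
by rewrite big_bool /= addnn -mul2n.
Qed.

Lemma degree_sprout_inr (b : bool) : degree (inr b : sprout) = 1.
Proof.
rewrite degreeE big_sumType /= big_bool /= addn0.
by rewrite (bigD1 x0) //= eqxx big1 // => i /negPf->.
Qed.

(** Two leaves appear, while [x0] stops being one since its degree becomes 3. *)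
Lemma card_leaves_sprout : degree x0 = 1 -> #|leaves sprout| = #|leaves T|.+1.
Proof.
move=> x0_leaf; rewrite /leaves -!sum1dep_card big_mkcond big_sumType /=.
rewrite big_bool /= !degree_sprout_inr /= addn2 [in RHS]big_mkcond /=.
rewrite (bigD1 x0) //= [in RHS](bigD1 x0) //=.
rewrite degree_sprout_inl x0_leaf eqxx /= add0n add1n; congr _.+2.
by apply: eq_bigr => x /negPf neq_x; rewrite degree_sprout_inl neq_x addn0.
Qed.

Lemma card_branch_vertices_sprout :
  degree x0 = 1 -> #|branch_vertices sprout| = #|branch_vertices T|.+1.
Proof.
move=> x0_leaf; rewrite /branch_vertices -!sum1dep_card big_mkcond.
rewrite big_sumType /= big_bool /= !degree_sprout_inr /= !addn0.
rewrite [in RHS]big_mkcond /= (bigD1 x0) //= [in RHS](bigD1 x0) //=.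
rewrite degree_sprout_inl x0_leaf eqxx /= add0n add1n; congr _.+1.
by apply: eq_bigr => x /negPf neq_x; rewrite degree_sprout_inl neq_x addn0.
Qed.

End Sprout.

(** A certificate stronger than [decomposition_tree], kept as the invariant of repeated
    sprouting. *)
Definition ranked_decomposition (G T : sgraph) (r : T -> nat)
    (sub : G -> {set T}) : Prop :=
  [/\ unique_parents r, rooted r [set: T], forall v, rooted r (sub v) &
      forall u v, u != v -> (adj u v <-> sub u :&: sub v != set0)].

Lemma ranked_decomposition_tree (G T : sgraph) (r : T -> nat)
    (sub : G -> {set T}) :
  ranked_decomposition r sub -> decomposition_tree sub.
Proof.
case=> uniqT rT rsub inter; split=> // [|v]; first exact: rooted_tree rT.
exact: rooted_subtree (rsub v).
Qed.

Lemma sprout_decomposition (G T : sgraph) (r : T -> nat) (sub : G -> {set T})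
    (x0 : T) :
  ranked_decomposition r sub ->
  ranked_decomposition (@sprout_rank T r x0)
    (fun v => [set inl x | x in sub v] : {set sprout x0}).
Proof.
case=> uniqT rT rsub inter; split=> [|||u v uv].
- exact: sprout_unique_parents.
- exact: sprout_rootedT.
- by move=> v; exact: sprout_rooted.
- apply: iff_trans (inter u v uv) _.
  rewrite -imsetI ?imset_eq0 //.
  by move=> x y _ _ [].
Qed.

Lemma ranked_decomposition_leaves (G T : sgraph) (r : T -> nat)
    (sub : G -> {set T}) (m : nat) :
  ranked_decomposition r sub -> 0 < #|leaves T| ->
  exists (T' : sgraph) (sub' : G -> {set T'}),
    [/\ decomposition_tree sub',
        #|branch_vertices T'| = #|branch_vertices T| + m &
        #|leaves T'| = #|leaves T| + m].
Proof.
elim: m T r sub => [|m IHm] T r sub dec leaf_gt0.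
  exists T, sub; rewrite !addn0; split=> //.
  exact: ranked_decomposition_tree dec.
have [x0] := card_gt0P leaf_gt0; rewrite inE => /eqP x0_leaf.
have [|T' [sub' []]] := IHm _ _ _ (sprout_decomposition x0 dec).
  by rewrite card_leaves_sprout.
rewrite card_leaves_sprout // card_branch_vertices_sprout // !addSnnS.
by exists T', sub'.
Qed.

(** * Exhaustive search for Hamiltonian cycles *)

Section HamiltonianSearch.
Variables (A : eqType) (e : rel A) (s : A).
Hypothesis e_sym : symmetric e.

(* The degree condition only prunes the search; the conditionals, unlike [&&],
   stay lazy under [vm_compute]. *)
Fixpoint closing_path (n : nat) (v : A) (l : seq A) : bool :=
  if n is n'.+1 then
    if all (fun w => 1 < count (e w) [:: v, s & l]) l then
      has (fun u => if e v u then closing_path n' u (rem u l) else false) l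
    else false
  else e v s.

(** Justifies the pruning: an inner vertex is adjacent to its predecessor and its successor. These
    lie at different positions of the list, so the count is 2 even when [v] equals [s]. *)
Lemma path_inner_degree (v w : A) (p : seq A) :
  path e v (rcons p s) -> w \in p -> 1 < count (e w) [:: v, s & p].
Proof.
move=> pth wp; case/splitPr: wp pth => p1 p2 pth.
have [p1w wp2] : e (last v p1) w /\ path e w (rcons p2 s).
  by move: pth; rewrite rcons_cat cat_path /= => /and3P[].
have /permP-> : perm_eq [:: v, s & p1 ++ w :: p2]
    ((v :: p1) ++ (w :: rcons p2 s)).
  by rewrite /= perm_cons -rcons_cons -rcons_cat perm_sym perm_rcons.
rewrite count_cat; apply: (@leq_add 1 1); rewrite -has_count; apply/hasP.
  by exists (last v p1); rewrite ?mem_last // e_sym.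
case: p2 wp2 {pth} => [|u p2] /= /andP[wu _].
  by exists s; rewrite // !inE eqxx orbT.
by exists u; rewrite // !inE eqxx orbT.
Qed.

(** Completeness of the search, used in contrapositive: a failed search excludes every closing path
    through the vertices of [l]. *)
Lemma closing_pathP (v : A) (p l : seq A) :
  path e v (rcons p s) -> perm_eq p l -> closing_path (size p) v l.
Proof.
elim: p v l => [|u p IHp] v l; first by move=> /= /andP[].
move=> pth pl /=; rewrite ifT.
  have ul : u \in l by rewrite -(perm_mem pl) mem_head.
  case/andP: pth => vu pth; apply/hasP; exists u => //; rewrite vu.
  by apply: IHp => //; rewrite -(perm_cons u) (perm_trans pl) // perm_to_rem.
apply/allP=> w; rewrite -(perm_mem pl) => /(path_inner_degree pth).
by move/permP: pl => /(_ (e w)) /= ->.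
Qed.

Lemma closing_path_cycle (c l : seq A) :
  cycle e c -> perm_eq c (s :: l) -> closing_path (size l) s l.
Proof.
move=> cc cl; have /rot_to[i c' rc] : s \in c.
  by rewrite (perm_mem cl) mem_head.
move: cc cl; rewrite -(rot_cycle i) -(perm_rot i) rc perm_cons => cc cl.
by rewrite -(perm_size cl); exact: closing_pathP.
Qed.

End HamiltonianSearch.

(** * Finite graphs given by computable relations on numbers *)

Section OrdGraph.
Variables (n : nat) (e : rel nat).
Hypotheses (e_sym : symmetric e) (e_irr : irreflexive e).

Lemma ord_adj_sym : symmetric (fun i j : 'I_n => e i j).
Proof. by move=> i j; exact: e_sym. Qed.

Lemma ord_adj_irr : irreflexive (fun i j : 'I_n => e i j).
Proof. by move=> i; exact: e_irr. Qed.

Definition ord_graph : sgraph := SGraph ord_adj_sym ord_adj_irr.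

Lemma ord_is_cycle (c : seq ord_graph) :
  is_cycle c = (2 < size c) && ucycleb e (map val c).
Proof.
by rewrite /is_cycle /ucycleb map_inj_uniq ?cycle_map //; exact: val_inj.
Qed.

Lemma ord_seq (s : seq nat) :
  all (gtn n) s -> exists c : seq ord_graph, map val c = s.
Proof.
elim: s => [|i s IHs] /=; first by exists [::].
by case/andP=> lt_in /IHs[c <-]; exists (Ordinal lt_in :: c).
Qed.

Lemma degree_ord_graph (i : ord_graph) :
  degree i = \sum_(0 <= j < n) e i j.
Proof. by rewrite degreeE big_mkord. Qed.

Lemma card_degree_ord_graph (P : pred nat) :
  #|[set i : ord_graph | P (degree i)]| =
  \sum_(0 <= i < n | P (\sum_(0 <= j < n) e i j)) 1.
Proof.
rewrite -sum1dep_card big_mkord; apply: eq_bigl => i.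
by rewrite degree_ord_graph.
Qed.

End OrdGraph.

(** * The graph and its decomposition tree *)

(* Found by a computer search over chordal graphs on 10 vertices with some edges
   forced into the cycles; the last five bags are the triangles that force
   these edges. *)
Definition bags : seq (seq nat) :=
  [:: [:: 0; 1; 2; 3; 4]; [:: 0; 1; 3; 4; 6]; [:: 1; 3; 4; 6; 8];
      [:: 3; 4; 6; 8; 9]; [:: 1; 2; 3; 4; 5]; [:: 1; 3; 5; 7];
      [:: 3; 9; 10]; [:: 4; 8; 11]; [:: 3; 7; 12]; [:: 1; 6; 13];
      [:: 4; 5; 14]].

Definition share_bag : rel nat := fun u v =>
  (u != v) && has (fun b => (u \in b) && (v \in b)) bags.

Lemma share_bag_sym : symmetric share_bag.
Proof.
move=> u v; rewrite /share_bag eq_sym; congr (_ && _).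
by apply: eq_has => b; rewrite andbC.
Qed.

Lemma share_bag_irr : irreflexive share_bag.
Proof. by move=> u; rewrite /share_bag eqxx. Qed.

Definition bag_graph : sgraph := ord_graph 15 share_bag_sym share_bag_irr.

(* The tree on the indices of [bags] is rooted at 0. *)
Definition bag_parent (i : nat) : nat :=
  nth 0 [:: 0; 0; 1; 2; 0; 4; 3; 2; 5; 1; 4] i.

(** The test [i != j] discards the loop at the root 0, which is its own [bag_parent]. *)
Definition bag_tree_adj : rel nat := fun i j =>
  (i != j) && ((bag_parent i == j) || (bag_parent j == i)).

Lemma bag_tree_adj_sym : symmetric bag_tree_adj.
Proof. by move=> i j; rewrite /bag_tree_adj eq_sym orbC. Qed.

Lemma bag_tree_adj_irr : irreflexive bag_tree_adj.
Proof. by move=> i; rewrite /bag_tree_adj eqxx. Qed.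

Definition bag_tree : sgraph := ord_graph 11 bag_tree_adj_sym bag_tree_adj_irr.

Definition bags_of (v : bag_graph) : {set bag_tree} :=
  [set i | val v \in nth [::] bags (val i)].

Lemma ord_all (n : nat) (P : pred nat) :
  all P (iota 0 n) -> forall i : 'I_n, P i.
Proof. by move=> /allP Pn i; apply: Pn; rewrite mem_iota ltn_ord. Qed.

Lemma bag_parent_lt (i : bag_tree) : val i != 0 -> bag_parent (val i) < val i.
Proof.
by apply/implyP; move: i;
  apply: (@ord_all 11 (fun i => (i != 0) ==> (bag_parent i < i))).
Qed.

(** Parents have smaller indices, so closure under parents away from [root] suffices. *)
Lemma bag_parent_rooted (S : {set bag_tree}) (root : bag_tree) :
  root \in S ->
  (forall i j : bag_tree, i \in S -> i != root -> val j = bag_parent (val i) ->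
     (val i != 0) && (j \in S)) ->
  @rooted bag_tree (@nat_of_ord 11) S.
Proof.
move=> rootS desc; exists root => // i iS neq_i.
have lt_p : bag_parent (val i) < 11.
  have [i0|i_neq0] := eqVneq (val i) 0; first by rewrite i0.
  exact: ltn_trans (bag_parent_lt i_neq0) (ltn_ord i).
have /andP[i_neq0 jS] := desc i (Ordinal lt_p) iS neq_i erefl.
exists (Ordinal lt_p); split=> //; last exact: bag_parent_lt.
by rewrite /adj /= /bag_tree_adj eqxx andbT gtn_eqF ?bag_parent_lt.
Qed.

Lemma bag_tree_unique_parents : @unique_parents bag_tree (@nat_of_ord 11).
Proof.
have parentE (i j : bag_tree) :
    adj i j -> val j <= val i -> val j = bag_parent (val i).
  case/andP=> neq_ij /orP[/eqP//|/eqP ji] le_ji.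
  have [j0|j_neq0] := eqVneq (val j) 0.
    by move: neq_ij; rewrite -ji [nat_of_ord j]j0.
  by move: (bag_parent_lt j_neq0); rewrite ji ltnNge le_ji.
move=> i j k ij ik ji ki; apply: val_inj.
by rewrite (parentE i j) // (parentE i k).
Qed.

Lemma bag_decomposition :
  @ranked_decomposition _ bag_tree (@nat_of_ord 11) bags_of.
Proof.
split.
- exact: bag_tree_unique_parents.
- apply: (@bag_parent_rooted _ ord0) => // i j _ neq_i _.
  by rewrite inE andbT; exact: neq_i.
(* Since parents have smaller indices, the root of the subtree of [v] must be the first bag
   containing [v]. *)
- move=> v; pose h := find (fun b : seq nat => val v \in b) bags.
  have lt_h : h < 11.
    by rewrite /h; move: v {h};
      apply: (@ord_all 15
        (fun v => find (fun b : seq nat => v \in b) bags < 11)).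
  apply: (@bag_parent_rooted _ (Ordinal lt_h)).
    by rewrite inE /=; apply: (@nth_find _ [::] (fun b => val v \in b));
      rewrite has_find.
  move=> i j; rewrite !inE -val_eqE /= /h => vi neq_i ->.
  have := @ord_all 15 (fun v => all (fun i =>
    [==> v \in nth [::] bags i,
         i != find (fun b : seq nat => v \in b) bags =>
         (i != 0) && (v \in nth [::] bags (bag_parent i))]) (iota 0 11)) isT v.
  by move=> /allP/(_ (val i)); rewrite mem_iota ltn_ord vi neq_i; apply.
- move=> u v uv; rewrite /adj /= /share_bag val_eqE uv andTb; split.
    case/hasP=> b /(nthP [::])[i lt_i <-] /andP[ui vi].
    by apply/set0Pn; exists (Ordinal (lt_i : i < 11)); rewrite !inE ui.
  case/set0Pn=> i; rewrite !inE => /andP[ui vi].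
  by apply/hasP; exists (nth [::] bags (val i));
    rewrite ?ui // mem_nth //; exact: ltn_ord.
Qed.

Lemma card_leaves_bag_tree : #|leaves bag_tree| = 5.
Proof.
rewrite /leaves (card_degree_ord_graph _ _ _ (fun d => d == 1)).
by rewrite unlock; vm_compute.
Qed.

Lemma card_branch_vertices_bag_tree : #|branch_vertices bag_tree| = 3.
Proof.
rewrite /branch_vertices (card_degree_ord_graph _ _ _ (fun d => 3 <= d)).
by rewrite unlock; vm_compute.
Qed.

(** * Cycles and chordality of the graph *)

Lemma bag_graph_hamiltonian : hamiltonian bag_graph.
Proof.
(* Each of 10, ..., 14 stands between its only two neighbours, cyclically. *)
pose s := [:: 10; 3; 12; 7; 1; 13; 6; 0; 2; 5; 14; 4; 11; 8; 9].
have [c cE] := @ord_seq 15 _ share_bag_sym share_bag_irr s isT.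
exists c; split=> [|v]; first by rewrite ord_is_cycle -(size_map val) cE.
rewrite -(mem_map val_inj) cE; move: v.
exact: (@ord_all 15 (fun i => i \in s) isT).
Qed.

Lemma bag_graph_connected : connected bag_graph.
Proof.
have [c [/andP[_ /andP[cc _]] cT]] := bag_graph_hamiltonian.
split=> [|u v]; first by rewrite card_ord.
exact: connect_cycle cc u v (cT u) (cT v).
Qed.

(* Removing the largest vertex first is a perfect elimination order. *)
Lemma bag_graph_chordal : chordal bag_graph.
Proof.
apply: (@chordal_elimination_order bag_graph (@nat_of_ord 15) val_inj).
move=> v u w vu vw uv wv uw.
have := @ord_all 15 (fun v => all (fun u => share_bag v u ==> all (fun w =>
  [==> share_bag v w, u != w => share_bag u w]) (iota 0 v)) (iota 0 v)) isT v.
move=> /allP/(_ (val u)); rewrite mem_iota => /(_ uv)/implyP/(_ vu).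
move=> /allP/(_ (val w)); rewrite mem_iota => /(_ wv).
by move=> /implyP/(_ vw)/implyP; apply.
Qed.

(** The search starts at 10, whose only neighbours are 3 and 9, so it branches little. *)
Lemma no_closing_path_missing (m : nat) :
  m \in [:: 0; 2] -> let l := rem 10 (rem m (iota 0 15)) in
  ~~ closing_path share_bag 10 (size l) 10 l.
Proof. by rewrite !inE => /orP[] /eqP->; vm_compute. Qed.

Lemma bag_graph_not_extendible : ~ cycle_extendible bag_graph.
Proof.
(* This cycle has 13 vertices and omits exactly 0 and 2, so an extension would omit exactly one of
   them. *)
pose s := [:: 10; 3; 12; 7; 5; 14; 4; 11; 8; 1; 13; 6; 9].
have [c cE] := @ord_seq 15 _ share_bag_sym share_bag_irr s isT.
have memc v : (v \in c) = (val v \in map val c).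
  by rewrite mem_map //; exact: val_inj.
move=> /(_ c); rewrite ord_is_cycle -(size_map val) cE => /(_ isT)[|c' []].
  by case=> _ /(_ ord0); rewrite memc cE.
rewrite ord_is_cycle => /and3P[_ cyc uniq_c'] sub_c size_c'.
have sub_c' : {subset s <= map val c'}.
  by rewrite -cE => _ /mapP[v vc ->]; rewrite map_f // sub_c.
have lt_c' i : i \in map val c' -> i < 15 by case/mapP=> v _ ->; exact: ltn_ord.
(* If [m] were absent, the 14 vertices of [c'] would be all the others, and the search would have
   succeeded. *)
have missing m : m \in [:: 0; 2] -> m \in map val c'.
  move=> m02; apply: contraT => m_c'.
  have [m10 size_rem] :
      10 \in rem m (iota 0 15) /\ size (rem m (iota 0 15)) = 14.
    by move: m02; rewrite !inE => /orP[] /eqP->.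
  have sub_rem : {subset map val c' <= rem m (iota 0 15)}.
    move=> i ic'; rewrite mem_rem_uniq ?iota_uniq // inE mem_iota.
    by rewrite leq0n lt_c' //= andbT; apply: contraNneq m_c' => <-.
  have perm_rem : perm_eq (map val c') (rem m (iota 0 15)).
    apply: uniq_perm; rewrite ?rem_uniq ?iota_uniq //.
    have [|_ //] := uniq_min_size uniq_c' sub_rem.
    by rewrite size_rem size_map size_c'.
  have := closing_path_cycle share_bag_sym cyc
    (perm_trans perm_rem (perm_to_rem m10)).
  by rewrite (negPf (no_closing_path_missing m02)).
(* Now [c'] contains 0, 2 and all of [s], that is 15 vertices, but its length is 14. *)
have all_c' : {subset iota 0 15 <= map val c'}.
  have in_c i : i \in iota 0 15 -> (i \in [:: 0; 2]) || (i \in s).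
    by move: i; exact/allP.
  by move=> i /in_c/orP[/missing|/sub_c'].
have := uniq_leq_size (iota_uniq 0 15) all_c'.
by rewrite size_map size_c'.
Qed.

Theorem theorem3p6 :
  forall t : nat, 5 <= t ->
    exists G : sgraph,
      [/\ connected G, hamiltonian G, chordal G, ~ fully_cycle_extendible G &
          exists (T : sgraph) (sub : G -> {set T}),
            [/\ decomposition_tree sub,
                #|branch_vertices T| = t - 2 &
                #|leaves T| = t]].
Proof.
move=> t t_ge5; exists bag_graph; split.
- exact: bag_graph_connected.
- exact: bag_graph_hamiltonian.
- exact: bag_graph_chordal.
- by case=> /bag_graph_not_extendible.
(* Starting from 5 leaves and 3 branch vertices, [t - 5] sproutings give [t] and [t - 2]. *)
- have [|T [sub [dec brT lvT]]] :=
    ranked_decomposition_leaves (t - 5) bag_decomposition.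
    by rewrite card_leaves_bag_tree.
  exists T, sub; split=> //.
    rewrite brT card_branch_vertices_bag_tree.
    by rewrite -{2}(subnK t_ge5) -addnBA // addnC.
  by rewrite lvT card_leaves_bag_tree subnKC.
Qed.
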